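(* Let $P=\mathrm{conv}\{v_1,\dots,v_n\}$ and $Q=\{x\in\mathbb{R}^3: Ax\le b\}$ be convex polytopes in $\mathbb{R}^3$, where $A$ is a real $m\times 3$ matrix with rows $a_1^T,\dots,a_m^T$ and $b=(b_1,\dots,b_m)^T\in\mathbb{R}^m$. Let $U\in SO(3)$, $\delta\in\mathbb{R}^3$, and $\eta\in\mathbb{R}^3$ with $\eta\ne 0$. Then the following are equivalent. (i) $P$ passes through $Q$ with certificate $(U,\eta,\delta)$. (ii) There exists a bipartition $(I_+,I_-)$ of the set $\{1,\dots,m\}$ such that both of the following hold: (1) for all $i\in I_+$, $a_i^T\eta\ge 0$, and for all $j\in I_-$, $a_j^T\eta\le 0$; (2) for all $1\le k\le n$, $i\in I_+$, $j\in I_-$, $$(b_j-a_j^T(Uv_k+\delta))(a_i^T\eta)\ \ge\ (b_i-a_i^T(Uv_k+\delta))(a_j^T\eta).$$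
   Context: A convex polytope in $\mathbb{R}^3$ is the convex hull of finitely many points, with non-empty interior. For $\eta\in\mathbb{R}^3\setminus\{0\}$, $\mathrm{proj}_\eta$ denotes the orthogonal projection of $\mathbb{R}^3$ onto the plane through the origin orthogonal to $\eta$. $P$ passes through $Q$ with certificate $(U,\eta,\delta)$ if $\mathrm{proj}_\eta(UP+\delta)\subseteq \mathrm{proj}_\eta(Q)$. A bipartition $(I_+,I_-)$ of a set is an ordered pair of disjoint subsets whose union is the whole set. Vector inequalities are componentwise. *)

(* Defs.v *)
From mathcomp Require Import all_boot all_order all_algebra.
From mathcomp Require Import all_classical all_reals all_analysis.

Set Implicit Arguments.
Unset Strict Implicit.
Unset Printing Implicit Defensive.

Import Order.TTheory GRing.Theory Num.Theory.
Import numFieldNormedType.Exports.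

Local Open Scope classical_set_scope.
Local Open Scope ring_scope.

(* Points of R^d are column vectors; the norm on ['cV[R]_d] is the sup norm,
   which induces the usual topology. *)

Definition convex_hull (R : realType) (d : nat) (S : set 'cV[R]_d) : set 'cV[R]_d :=
  smallest (@convex_set R 'cV[R]_d) S.

Definition convex_polytope (R : realType) (d : nat) (S : set 'cV[R]_d) : Prop :=
  (exists F : set 'cV[R]_d, finite_set F /\ S = convex_hull F) /\ interior S !=set0.

Definition special_orthogonal (R : realType) (d : nat) : set 'M[R]_d :=
  [set U | U^T *m U = 1%:M /\ \det U = 1].

(* [orth_proj eta] projects onto the hyperplane through the origin orthogonal to
   [eta]; it is meant for [eta <> 0] only. *)
Definition orth_proj (R : realType) (d : nat) (eta x : 'cV[R]_d) : 'cV[R]_d :=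
  x - ((eta^T *m x) 0 0 / (eta^T *m eta) 0 0) *: eta.

Definition passes_through (R : realType) (d : nat) (P Q : set 'cV[R]_d)
    (U : 'M[R]_d) (eta delta : 'cV[R]_d) : Prop :=
  orth_proj eta @` [set U *m x + delta | x in P] `<=` orth_proj eta @` Q.

Definition bipartition (T : finType) (Ip Im : {set T}) : Prop :=
  Ip :&: Im = finset.set0 /\ Ip :|: Im = finset.setT.

(* Main.v *)
Require Import Defs.
From mathcomp Require Import all_boot all_order all_algebra.
From mathcomp Require Import all_classical all_reals all_analysis.

Import Order.TTheory GRing.Theory Num.Theory.
Import numFieldNormedType.Exports.

Local Open Scope classical_set_scope.
Local Open Scope ring_scope.

Set Implicit Arguments.
Unset Strict Implicit.

(** Write [c = A *m eta].  Two points have the same projection along [eta] iff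
    they differ by a multiple of [eta] ([orth_proj_eqP]), so the projection of
    a point [y] lies in the projection of [Q] iff the line [y + t *: eta] meets
    [Q], that is, iff the scalar inequalities [t * c_i <= s_i] are solvable in
    [t], where [s = b - A *m y] is the vector of slacks.  By Fourier-Motzkin
    elimination this holds iff every lower bound, coming from some [c_j < 0],
    is at most every upper bound, coming from some [c_i > 0], and [s_i >= 0]
    whenever [c_i = 0].  The products [s_i * c_j <= s_j * c_i] express the first
    condition.  They also express the second, provided that [c] takes both
    signs: pairing an index where [c] vanishes with one where [c] has the
    opposite strict sign forces the slack to be nonnegative
    ([slab_solvable]).  Both signs do occur because [Q] is nonempty and
    bounded, hence contains no ray in the direction [eta] or [- eta]
    ([bounded_polyhedron_escape]).

    It is enough to test the vertices of [P]: the points whose image lies over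
    the projection of [Q] form a convex set ([passes_through_vertices]). *)

Lemma dotmx_self_gt0 (R : realType) (d : nat) (eta : 'cV[R]_d) :
  eta <> 0 -> 0 < (eta^T *m eta) 0 0.
Proof.
move=> eta0; rewrite mxE.
have ge0 (i : 'I_d) : true -> 0 <= eta^T 0 i * eta i 0.
  by move=> _; rewrite mxE -expr2 sqr_ge0.
rewrite lt_neqAle sumr_ge0 // andbT eq_sym; apply/negP.
rewrite psumr_eq0 // => /allP z; apply: eta0; apply/colP => i.
have := z i (mem_index_enum i); rewrite !mxE /= mulf_eq0 orbb.
by move/eqP.
Qed.

Lemma mulmx_lineE (R : realType) (m d n : nat) (B : 'M[R]_(m, d))
    (x y : 'M[R]_(d, n)) t i j :
  (B *m (x + t *: y)) i j = (B *m x) i j + t * (B *m y) i j.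
Proof. by rewrite mulmxDr -scalemxAr mxE; congr (_ + _); rewrite mxE. Qed.

Lemma orth_proj_eqP (R : realType) (d : nat) (eta x y : 'cV[R]_d) :
  eta <> 0 ->
  orth_proj eta x = orth_proj eta y <-> exists t, y = x + t *: eta.
Proof.
move=> /dotmx_self_gt0 eta0; rewrite /orth_proj; split=> [e|[t ->]].
  exists ((eta^T *m y) 0 0 / (eta^T *m eta) 0 0
          - (eta^T *m x) 0 0 / (eta^T *m eta) 0 0).
  by rewrite scalerBl addrCA e addrC subrK.
rewrite mulmx_lineE mulrDl mulfK ?gt_eqF // scalerDl opprD addrACA.
by rewrite subrr addr0.
Qed.

Lemma mulmx_convE (R : realType) (m d n : nat) (B : 'M[R]_(m, d))
    (l : {i01 R}) (x y : convex_lmodType 'M[R]_(d, n)) i j :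
  (B *m conv l x y : 'M[R]_(m, n)) i j =
  conv l ((B *m x) i j : R^o) ((B *m y) i j).
Proof.
by rewrite /conv /= mulmxDr -!scalemxAr mxE; congr (_ + _); rewrite mxE.
Qed.

Lemma finite_set_ubound (R : realType) (T : choiceType) (F : set T)
    (f : T -> R) :
  finite_set F -> exists M, forall x, F x -> f x <= M.
Proof.
move=> /finite_seqP[s ->]; elim: s => [|a s [M hM]]; first by exists 0.
exists (Num.max (f a) M) => x /=; rewrite inE le_max => /orP[/eqP->|xs].
  by rewrite lexx.
by rewrite (hM x xs) orbT.
Qed.

(** Half-spaces are convex, so a half-space that contains the generators
    contains their hull. *)
Lemma convex_hull_linear_ubound (R : realType) (d : nat) (F : set 'cV[R]_d)
    (w : 'rV[R]_d) :
  finite_set F -> exists M, forall x, convex_hull F x -> (w *m x) 0 0 <= M.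
Proof.
move=> finF; have [M hM] := finite_set_ubound (fun x => (w *m x) 0 0) finF.
exists M; apply: smallest_sub => //= x y l; rewrite !inE /= => hx hy.
rewrite mulmx_convE -[M](convmm l (M : R^o)) !convRE.
by apply: lerD; rewrite ler_wpM2l // ?subr_ge0.
Qed.

(** If no constraint increased along [eta], the ray from a point of the
    polyhedron in the direction [eta] would stay inside, whereas
    [eta^T *m _] is unbounded on that ray. *)
Lemma bounded_polyhedron_escape (R : realType) (d m : nat)
    (A : 'M[R]_(m, d)) (b : 'cV[R]_m) (eta : 'cV[R]_d) :
  convex_polytope [set x | forall i, (A *m x) i 0 <= b i 0] -> eta <> 0 ->
  exists i, 0 < (A *m eta) i 0.
Proof.
move=> [[F [finF QF]] [x0 /interior_subset x0Q]] /dotmx_self_gt0 eta0.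
have [M hM] := convex_hull_linear_ubound eta^T finF.
apply: contrapT => noi.
have c_le0 i : (A *m eta) i 0 <= 0.
  by rewrite leNgt; apply/negP => ci; apply: noi; exists i.
have ray t : 0 <= t -> (eta^T *m x0) 0 0 + t * (eta^T *m eta) 0 0 <= M.
  move=> t0.
  have : convex_hull F (x0 + t *: eta).
    rewrite -QF /= => i; rewrite mulmx_lineE.
    by rewrite -[leRHS]addr0 lerD // mulr_ge0_le0.
  by move=> /hM; rewrite mulmx_lineE.
have M0 : 0 <= M - (eta^T *m x0) 0 0.
  by have := ray 0 (lexx 0); rewrite mul0r addr0 subr_ge0.
(* At this parameter the functional takes the value M + eta^T *m eta. *)
pose t := (M - (eta^T *m x0) 0 0) / (eta^T *m eta) 0 0 + 1.
have /ray : 0 <= t by rewrite addr_ge0 // divr_ge0 // ltW.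
rewrite /t mulrDl divfK ?gt_eqF // mul1r addrA subrKC gerDl.
by rewrite leNgt eta0.
Qed.

(** Fourier-Motzkin elimination of one variable: the tightest upper bound
    [s_i / c_i] with [c_i > 0] solves the system.  The indices [p] and [q]
    settle the constraints with [c_i = 0], whichever of the two blocks they
    were put in. *)
Lemma slab_solvable (R : realType) (I : finType) (s c : I -> R)
    (Ip Im : {set I}) (p q : I) :
  bipartition Ip Im ->
  (forall i, i \in Ip -> 0 <= c i) -> (forall j, j \in Im -> c j <= 0) ->
  (forall i j, i \in Ip -> j \in Im -> s i * c j <= s j * c i) ->
  0 < c p -> c q < 0 -> exists t, forall i, t * c i <= s i.
Proof.
move=> [_ IpIm] cIp cIm sc cp cq.
have cover i : (i \in Ip) || (i \in Im).
  by rewrite -finset.in_setU IpIm finset.in_setT.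
have posIp i : 0 < c i -> i \in Ip.
  by move=> ci; case/orP: (cover i) => // /cIm; rewrite leNgt ci.
have negIm j : c j < 0 -> j \in Im.
  by move=> cj; case/orP: (cover j) => // /cIp; rewrite leNgt cj.
pose r := [arg min_(i < p | 0 < c i) (s i / c i)]%O.
exists (s r / c r); rewrite /r; case: arg_minP => // {}r cr rmin i.
case: (ltgtP (c i) 0) => [ci|ci|ci].
- rewrite mulrAC ler_pdivrMr //; exact: sc (posIp _ cr) (negIm _ ci).
- by rewrite -ler_pdivlMr // rmin.
rewrite ci mulr0; case/orP: (cover i) => iI.
- by have := sc _ _ iI (negIm _ cq); rewrite ci mulr0 nmulr_lle0.
- by have := sc _ _ (posIp _ cp) iI; rewrite ci mulr0 pmulr_lge0.
Qed.

(** A convex combination of solutions [t] for two points is a solution for the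
    convex combination of the points, so solvability spreads from the
    generators to the hull. *)
Lemma passes_through_vertices (R : realType) (d m : nat) (V : set 'cV[R]_d)
    (A : 'M[R]_(m, d)) (b : 'cV[R]_m) (U : 'M[R]_d) (eta delta : 'cV[R]_d) :
  eta <> 0 ->
  passes_through (convex_hull V) [set x | forall i, (A *m x) i 0 <= b i 0]
    U eta delta <->
  forall x, V x -> exists t, forall i,
    t * (A *m eta) i 0 <= b i 0 - (A *m (U *m x + delta)) i 0.
Proof.
move=> eta0.
have lineE x t i : (A *m (x + t *: eta)) i 0 <= b i 0 <->
    t * (A *m eta) i 0 <= b i 0 - (A *m x) i 0.
  by rewrite mulmx_lineE lerBrDl.
split=> [pass x Vx|solv].
  have [|y yQ /esym/(orth_proj_eqP _ _ eta0)[t yE]] :=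
    pass (orth_proj eta (U *m x + delta)).
    exists (U *m x + delta) => //; exists x => //.
    exact: (sub_gen_smallest Vx).
  by exists t => i; apply/lineE; rewrite -yE; exact: yQ.
suff hull x : convex_hull V x -> exists t, forall i,
    t * (A *m eta) i 0 <= b i 0 - (A *m (U *m x + delta)) i 0.
  move=> _ [_ [x /hull[t ht] <-] <-].
  exists (U *m x + delta + t *: eta); first by move=> i; apply/lineE.
  by apply/esym/orth_proj_eqP => //; exists t.
move: x; apply: smallest_sub => //= x y l; rewrite !inE /=.
move=> [tx hx] [ty hy]; exists (conv l (tx : R^o) ty) => i.
have -> : U *m conv l (x : convex_lmodType _) y + delta =
    conv l (U *m x + delta : convex_lmodType _) (U *m y + delta).
  rewrite -[in LHS](convmm l (delta : convex_lmodType _)) /conv /= mulmxDr.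
  by rewrite -!scalemxAr !scalerDr addrACA.
rewrite mulmx_convE -[b i 0](convmm l (b i 0 : R^o)) !convRE.
rewrite mulrDl opprD addrACA.
rewrite -!mulrA -!mulrBr; apply: lerD; apply: ler_wpM2l => //.
by rewrite subr_ge0.
Qed.

Theorem theorem15 (R : realType) (n m : nat) (v : 'I_n -> 'cV[R]_3)
    (A : 'M[R]_(m, 3)) (b : 'cV[R]_m) (P Q : set 'cV[R]_3)
    (hP : P = convex_hull (range v))
    (hQ : Q = [set x | forall i : 'I_m, (A *m x) i 0 <= b i 0])
    (hPpoly : convex_polytope P) (hQpoly : convex_polytope Q)
    (U : 'M[R]_3) (hU : special_orthogonal U)
    (delta eta : 'cV[R]_3) (eta_neq0 : eta <> 0) :
  passes_through P Q U eta delta <->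
  exists Ip Im : {set 'I_m},
    bipartition Ip Im /\
    ((forall i : 'I_m, i \in Ip -> (row i A *m eta) 0 0 >= 0) /\
     (forall j : 'I_m, j \in Im -> (row j A *m eta) 0 0 <= 0)) /\
    (forall (k : 'I_n) (i j : 'I_m), i \in Ip -> j \in Im ->
       (b j 0 - (row j A *m (U *m v k + delta)) 0 0) * (row i A *m eta) 0 0 >=
       (b i 0 - (row i A *m (U *m v k + delta)) 0 0) * (row j A *m eta) 0 0).
Proof.
have rowE i (x : 'cV[R]_3) : (row i A *m x) 0 0 = (A *m x) i 0.
  by rewrite -row_mul mxE.
rewrite hP hQ passes_through_vertices //; split=> [solv|].
  exists (finset (fun i => 0 <= (A *m eta) i 0)),
    (finset (fun i => (A *m eta) i 0 < 0)).
  split; [split|split; [split|]].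
  - by apply/setP => i; rewrite !inE ltNge andbN.
  - by apply/setP => i; rewrite !inE ltNge orbN.
  - by move=> i; rewrite inE rowE.
  - by move=> i; rewrite inE rowE => /ltW.
  move=> k i j; rewrite !inE !rowE => ci cj.
  have [t ht] := solv (v k) (imageT v k).
  (* Both sides are separated by t * c_i * c_j. *)
  apply: (@le_trans _ _ (t * (A *m eta) i 0 * (A *m eta) j 0)).
    by rewrite ler_wnM2r // ltW.
  by rewrite mulrAC ler_wpM2r.
move=> [Ip [Im [bip [[cIp cIm] sc]]]] _ [k _ <-].
rewrite hQ in hQpoly.
have [p cp] := bounded_polyhedron_escape hQpoly eta_neq0.
have Neta0 : - eta <> 0 by move/eqP; rewrite oppr_eq0 => /eqP.
have [q] := bounded_polyhedron_escape hQpoly Neta0.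
rewrite mulmxN mxE oppr_gt0 => cq.
apply: (slab_solvable (s := fun i => b i 0 - (A *m (U *m v k + delta)) i 0)
          (c := fun i => (A *m eta) i 0) bip _ _ _ cp cq) => //.
- by move=> i /cIp; rewrite rowE.
- by move=> j /cIm; rewrite rowE.
- by move=> i j iI jI; have := sc k i j iI jI; rewrite !rowE.
Qed.
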